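(* Fix a round $t$ and state $s_t$. Let $\pi_\theta=\prod_{i\in\mathcal{N}_t}\pi_\theta^i$ be a factorized categorical policy whose action probabilities $\pi_\theta^i(a\mid o_{i,t})$ are positive and differentiable in $\theta\in\mathbb{R}^d$, let $x_{(i,a)}(\theta)=\pi_\theta^i(a\mid o_{i,t})$, and define the conditional stage objective $J_t(\theta;s_t)=\mathbb{E}_{A_t\sim\pi_\theta}[F_t(A_t;s_t)\mid s_t]=\tilde f_t(\mathbf{x}(\theta);s_t)$. Then $$\nabla_\theta J_t(\theta;s_t)=\mathbb{E}_{A_t\sim\pi_\theta}\Big[\sum_{i\in\mathcal{N}_t}\nabla_\theta\log\pi_\theta^i(a_{i,t}\mid o_{i,t})\,\big(F_t((i,a_{i,t})\mid A_t^{-i};s_t)-b_{i,t}\big)\Big],$$ where, for each $i$, $b_{i,t}$ is any (integrable) term independent of $a_{i,t}$ conditional on $s_t$, $o_{i,t}$ and the other agents' sampled actions.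
   Context: $\mathcal{N}_t$ is a finite set of agents; each agent $i$ has a finite nonempty action set $\mathcal{A}_{i,t}$ and a local observation $o_{i,t}$ determined by $s_t$. $\Omega_t=\{(i,a):i\in\mathcal{N}_t,a\in\mathcal{A}_{i,t}\}$, $\Omega_{i,t}=\{(i,a):a\in\mathcal{A}_{i,t}\}$, $\mathcal{I}_t=\{A\subseteq\Omega_t:|A\cap\Omega_{i,t}|\le1\ \forall i\}$. Each $\pi_\theta^i(\cdot\mid o_{i,t})$ is a probability distribution on $\mathcal{A}_{i,t}$; under $\pi_\theta$ agents sample $a_{i,t}$ independently given $s_t$; $A_t=\{(i,a_{i,t}):i\in\mathcal{N}_t\}$ and $A_t^{-i}=A_t\setminus\{(i,a_{i,t})\}$. $F_t(\cdot;s_t):2^{\Omega_t}\to\mathbb{R}_{\ge0}$ is normalized, monotone and submodular (standing assumption), and $F_t(e\mid A;s_t)=F_t(A\cup\{e\};s_t)-F_t(A;s_t)$. Partition Multilinear Extension: $\tilde f_t(\mathbf{x};s_t)=\sum_{A\in\mathcal{I}_t}F_t(A;s_t)\prod_{i\in\mathcal{N}_t}p_i(A;\mathbf{x})$, where $p_i(A;\mathbf{x})=x_{(i,a)}$ if $A\cap\Omega_{i,t}=\{(i,a)\}$ and $p_i(A;\mathbf{x})=1-\sum_{a'\in\mathcal{A}_{i,t}}x_{(i,a')}$ if $A\cap\Omega_{i,t}=\emptyset$. *)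

(* Defs.v *)
From HB Require Import structures.
From mathcomp Require Import all_boot all_order all_algebra.
From mathcomp Require Import all_classical all_reals all_analysis.
Set Implicit Arguments.
Unset Strict Implicit.
Unset Printing Implicit Defensive.
Import Order.TTheory GRing.Theory Num.Theory.
Import numFieldNormedType.Exports.
Local Open Scope classical_set_scope.
Local Open Scope ring_scope.

Section GroundSet.
Context {N : finType} {A : N -> finType}.

Definition ground : finType := {i : N & A i}.

Definition block (i : N) : {set ground} := [set e | tag e == i]%SET.

Definition feasible (S : {set ground}) : bool :=
  [forall i, #|S :&: block i| <= 1]%N.

Definition joint (a : forall i, A i) : {set ground} :=
  [set Tagged A (a i) | i : N]%SET.

Definition joint_except (a : forall i, A i) (i : N) : {set ground} :=
  (joint a :\ Tagged A (a i))%SET.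

End GroundSet.
Arguments ground {N} A.

Section SetFunction.
Context {R : realType} {E : finType}.
Implicit Types (F : {set E} -> R) (S : {set E}) (e : E).

Definition marginal F e S : R := F (e |: S)%SET - F S.

Definition normalized_setfun F : Prop := F finset.set0 = 0.

Definition monotone_setfun F : Prop :=
  forall S1 S2 : {set E}, S1 \subset S2 -> F S1 <= F S2.

Definition submodular_setfun F : Prop :=
  forall (S1 S2 : {set E}) e, S1 \subset S2 -> e \notin S2 ->
    marginal F e S2 <= marginal F e S1.

End SetFunction.

Section PartitionMultilinearExtension.
Context {R : realType} {N : finType} {A : N -> finType}.

(* On a feasible [S], [S :&: block i] is either a singleton, found by [pick],
   or empty, in which case [pick] returns [None]. *)
Definition pme_factor (x : ground A -> R) (S : {set ground A}) (i : N) : R :=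
  if [pick a : A i | (S :&: block i)%SET == [set Tagged A a]%SET] is Some a
  then x (Tagged A a)
  else 1 - \sum_(a : A i) x (Tagged A a).

Definition pme (F : {set ground A} -> R) (x : ground A -> R) : R :=
  \sum_(S : {set ground A} | feasible S) F S * \prod_(i : N) pme_factor x S i.

End PartitionMultilinearExtension.

Definition grad {R : realType} {n : nat} (f : 'rV[R]_n -> R) (theta : 'rV[R]_n)
  : 'rV[R]_n := \row_(k < n) 'D_(delta_mx 0 k) f theta.

Section Sampling.
Context {R : realType} {N : finType} {A : N -> finType}.
Context {d : measure_display} {T : measurableType d}.
Implicit Types (P : probability T R) (X : T -> forall i, A i).

Definition action_measurable X : Prop :=
  forall i (a : A i), measurable [set w | X w i = a].

(* The joint probability mass function of the actions is the product of the
   [p i]: the actions are independent and the one of agent [i] has law [p i]. *)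
Definition sampled_from P X (p : forall i, A i -> R) : Prop :=
  forall a : forall i, A i,
    P [set w | forall i, X w i = a i] = (\prod_(i : N) p i (a i))%:E.

Definition cond_prob P (E C : set T) : R := fine (P (E `&` C)) / fine (P C).

Definition others_play X (i : N) (c : forall j, A j) : set T :=
  [set w | forall j, j != i -> X w j = c j].

(* Conditional independence of [b] and the action of agent [i] given the actions
   of all the other agents. The coordinate [c i] plays no role; on a null
   conditioning event the equation reads 0 = 0, since [x / 0 = 0]. *)
Definition cond_indep_own_action P X (i : N) (b : T -> R) : Prop :=
  forall (c : forall j, A j) (a : A i) (B : set R), measurable B ->
    cond_prob P ((b @^-1` B) `&` [set w | X w i = a]) (others_play X i c) =
    cond_prob P (b @^-1` B) (others_play X i c) *
    cond_prob P [set w | X w i = a] (others_play X i c).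

End Sampling.

(* Main.v *)
(* The objective is the finite sum over joint actions [a] of [F a * prod_i q_i(a_i)],
   and the logarithmic derivative of the product gives the score-function formula
   with the full reward [F a]. Subtracting [F (a \ a_i)] and the baseline [b_i]
   from the reward multiplying agent [i]'s score does not change the expectation:
   given the other actions, both see [a_i] only through its law [q_i], and the
   score averages to the derivative of [sum_c q_i(c) = 1], that is, to 0. *)

Require Import Defs.
From HB Require Import structures.
From mathcomp Require Import all_boot all_order all_algebra.
From mathcomp Require Import all_classical all_reals all_analysis.
From mathcomp Require Import measurable_realfun ring.
Import Order.TTheory GRing.Theory Num.Theory.
Import numFieldNormedType.Exports.
Local Open Scope classical_set_scope.
Local Open Scope ring_scope.

(** * Integrals over events where the laws of the integrand are proportional, and over finite
    partitions *)

(** Change of variables turns both integrals into integrals of [h] against the laws of [b] on [D1]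
    and [D2], which are proportional. Each law is realized by extending [b] by 0, which spoils only
    the mass at 0, where [h] vanishes. *)
Lemma ge0_integral_comp_scale (d : measure_display) (T : measurableType d)
  (R : realType) (mu : {measure set T -> \bar R}) (D1 D2 : set T) (b : T -> R)
  (k : R) (h : measurableTypeR R -> \bar R) :
  measurable D1 -> measurable D2 -> measurable_fun setT b -> 0 <= k ->
  (forall B, measurable B ->
    mu (b @^-1` B `&` D1) = (k%:E * mu (b @^-1` B `&` D2))%E) ->
  measurable_fun setT h -> (forall y, 0 <= h y)%E -> h 0 = 0%E ->
  (\int[mu]_(x in D1) h (b x) = k%:E * \int[mu]_(x in D2) h (b x))%E.
Proof.
move=> mD1 mD2 mb k0 muE mh h_ge0 h00.
(* Away from 0, the law of [b] extended by 0 outside of [E] is that of its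
   restriction to [E]. *)
have patch_preimage (D B : set _) : B `<=` ~` [set 0] ->
    (b \_ D) @^-1` B = b @^-1` B `&` D.
  move=> B0; apply/seteqP; split=> x /=; rewrite patchE.
    by case: ifPn => [/set_mem //|_ /B0 /(_ erefl)].
  by move=> [Bb Dx]; rewrite mem_set.
have m0 : measurable (~` [set (0 : R)]) by exact: measurableC (measurable_set1 _).
have mpatch D : measurable D -> measurable_fun setT (b \_ D).
  by move=> mD; apply: (measurable_restrictT _ mD).1; exact: measurable_funTS.
have intE E (mE : measurable E) : (\int[mu]_(x in E) h (b x) =
    \int[pushforward mu (b \_ E)]_(y in ~` [set 0%R]) h y)%E.
  rewrite [RHS]ge0_integral_pushforward//; [|exact: mpatch|exact: measurable_funTS].
  rewrite patch_preimage// integral_mkcond [RHS]integral_mkcond.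
  (* The points of [E] missing from the preimage satisfy [b x = 0], and contribute [h 0 = 0]. *)
  apply: eq_integral => x _; rewrite !patchE in_setI.
  case: ifPn => xE; rewrite ?andbF//= andbT ?xE; case: ifPn => //.
    by rewrite patchE xE.
  by rewrite notin_setE/= => /contrapT ->.
rewrite !intE//.
rewrite -(ge0_integral_mscale _ _ (NngNum k0))//; last exact: measurable_funTS.
  exact: mpatch.
move=> mpatch2; apply: eq_measure_integral => [|? B mB B0]; first exact: mpatch.
rewrite -[LHS]/(mu ((b \_ D1) @^-1` B)) -[RHS]/(k%:E * mu ((b \_ D2) @^-1` B))%E.
by rewrite !patch_preimage// muE.
Qed.

(** The positive and negative parts of [b] are nonnegative functions of [b] vanishing at 0, so the
    previous lemma applies to each. *)
Lemma Rintegral_comp_scale (d : measure_display) (T : measurableType d)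
  (R : realType) (mu : {measure set T -> \bar R}) (D1 D2 : set T) (b : T -> R)
  (k : R) :
  measurable D1 -> measurable D2 -> mu.-integrable setT (EFin \o b) -> 0 <= k ->
  (forall B, measurable B ->
    mu (b @^-1` B `&` D1) = (k%:E * mu (b @^-1` B `&` D2))%E) ->
  \int[mu]_(x in D1) b x = k * \int[mu]_(x in D2) b x.
Proof.
move=> mD1 mD2 ib k0 muE.
have mb : measurable_fun setT b by apply/measurable_EFinP; case/integrableP: ib.
have iD D : measurable D -> mu.-integrable D (EFin \o b).
  by move=> mD; exact: integrableS ib.
suff intE : (\int[mu]_(x in D1) (b x)%:E = k%:E * \int[mu]_(x in D2) (b x)%:E)%E.
  by rewrite /Rintegral intE fineM// integrable_fin_num//; exact: iD.
have fin_pos D : measurable D ->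
    (\int[mu]_(x in D) ((EFin \o b)^\+ x) \is a fin_num)%E.
  by move=> mD; apply: integrable_fin_num => //; exact: integrable_funepos (iD _ mD).
have mEFin : measurable_fun [set: measurableTypeR R] (@EFin R) by exact/measurable_EFinP.
rewrite [LHS]integralE [in RHS]integralE muleBr//; last first.
  by rewrite fin_num_adde_defr// fin_pos.
rewrite -[fun x => (b x)%:E]/(@EFin R \o b) funepos_comp funeneg_comp.
congr (_ - _)%E; apply: ge0_integral_comp_scale => //.
- exact: measurable_funepos.
- by rewrite funeposE maxxx.
- exact: measurable_funeneg.
- by rewrite funenegE oppe0 maxxx.
Qed.

Lemma Rintegral_sum (d : measure_display) (T : measurableType d)
  (R : realType) (mu : {measure set T -> \bar R}) (D : set T) (I : finType)
  (f : I -> T -> R) :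
  measurable D -> (forall i, mu.-integrable D (EFin \o f i)) ->
  \int[mu]_(x in D) (\sum_i f i x) = \sum_i \int[mu]_(x in D) f i x.
Proof.
move=> mD intf; rewrite /Rintegral.
under eq_integral do rewrite -sumEFin.
rewrite (integral_sum mD (f := fun i => EFin \o f i))// sum_fine// => i _.
exact: (integrable_fin_num mD (intf i)).
Qed.

(** The integrand is cut along the values of [Y]. It depends on the sample point besides [Y] to
    allow for baselines, which need not be functions of the joint action. *)
Lemma expectation_fin_partition (d : measure_display) (T : measurableType d)
  (R : realType) (P : probability T R) (I : finType) (Y : T -> I)
  (h : I -> T -> R) :
  (forall i, measurable (Y @^-1` [set i])) ->
  (forall i, P.-integrable setT (EFin \o h i)) ->
  'E_P[fun w => h (Y w) w]%E =
  (\sum_i \int[P]_(w in Y @^-1` [set i]) h i w)%:E.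
Proof.
move=> mY ih; rewrite unlock.
have -> : (fun w => (h (Y w) w)%:E) =
    (fun w => \sum_(i : I) ((EFin \o h i) \_ (Y @^-1` [set i])) w)%E.
  apply/funext => w; rewrite (bigD1 (Y w))//= big1 ?adde0.
    by rewrite patchE mem_set.
  by move=> i iY; rewrite patchE memNset//= => Yi; move: iY; rewrite Yi eqxx.
rewrite integral_sum//.
  rewrite -sumEFin; apply: eq_bigr => i _.
  rewrite -integral_mkcond fineK// integrable_fin_num//.
  exact: integrableS (ih i).
move=> i; apply: (integrable_mkcond _ (mY i)).1.
by apply: integrableS (ih i).
Qed.

(** * Changing the action of one agent *)

Section Updates.
Context {N : finType} {A : N -> finType}.
Implicit Types a : {dffun forall i, A i}.

(** The result of [dfwith] is made a finite function again, so that it stays in a finite type over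
    which sums can be taken. *)
Definition upd (a : {dffun forall i, A i}) (i : N) (c : A i) :
  {dffun forall i, A i} := finfun (dfwith a i c).

Lemma upd_eq a (i : N) (c : A i) : upd a i c i = c.
Proof. by rewrite ffunE dfwithin. Qed.

Lemma upd_neq a (i : N) (c : A i) j : j != i -> upd a i c j = a j.
Proof. by move=> ji; rewrite ffunE dfwithout// eq_sym. Qed.

(* [(a, c) |-> (upd a i c, a i)] is an involution: it moves the dependence on the
   value at [i] to an independent summation variable. *)
Lemma sum_upd_eq0 (R : numDomainType) i (u : A i -> R)
    (h : {dffun forall i, A i} -> R) :
  (0 < #|A i|)%N -> \sum_c u c = 0 ->
  (forall a c, h (upd a i c) = h a) ->
  \sum_(a : {dffun forall i, A i}) u (a i) * h a = 0.
Proof.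
move=> A_gt0 u0 hE; apply/eqP.
(* The factor [#|A i|] introduces a free variable in [A i], giving the involution pairs to act
   on. *)
suff : (\sum_(a : {dffun forall i, A i}) u (a i) * h a) *+ #|A i| == 0.
  by rewrite mulrn_eq0 eqn0Ngt A_gt0.
rewrite -sumrMnl.
under eq_bigr do rewrite -sumr_const.
rewrite pair_big/=.
pose swap (p : {dffun forall i, A i} * A i) := (upd p.1 i p.2, p.1 i).
have swapK : involutive swap.
  move=> [a c]; rewrite /swap/= upd_eq; congr (_, _).
  apply/ffunP => j; have [->|ji] := eqVneq j i; first by rewrite upd_eq.
  by rewrite !upd_neq.
rewrite (reindex_inj (inv_inj swapK))/=.
under eq_bigr do rewrite upd_eq hE.
rewrite -(pair_bigA _ (fun a c => u c * h a))/= big1// => a _.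
by rewrite -mulr_suml u0 mul0r.
Qed.

End Updates.

(** * Joint actions as feasible sets, and the multilinear extension at product distributions *)

Section Joint.
Context {N : finType} {A : N -> finType}.

Lemma in_joint (a : forall i, A i) (e : ground A) :
  (e \in joint a) = (tagged e == a (tag e)).
Proof.
case: e => i c /=; apply/imsetP/eqP => [[j _]|->]; last by exists i.
move=> /eqP; rewrite -tag_eqE /tag_eq/= => /andP[/eqP ij].
by case: _ / ij c => c; rewrite tagged_asE => /eqP.
Qed.

Lemma joint_finfun (a : forall i, A i) :
  joint (finfun a : {dffun forall i, A i}) = joint a.
Proof. by apply/setP => e; rewrite !in_joint ffunE. Qed.

Lemma joint_inj : injective (fun a : {dffun forall i, A i} => joint a).
Proof.
move=> a a' /setP eq_aa'; apply/ffunP => i.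
by have := eq_aa' (Tagged A (a i)); rewrite !in_joint/= eqxx => /esym/eqP.
Qed.

Lemma joint_block (a : forall i, A i) (i : N) :
  (joint a :&: block i)%SET = [set Tagged A (a i)]%SET.
Proof.
apply/setP => e; rewrite !inE in_joint; apply/andP/eqP => [[]|->]; last by rewrite !eqxx.
by case: e => j c /= /eqP -> /eqP ->.
Qed.

Lemma feasible_joint (a : forall i, A i) : feasible (joint a).
Proof. by apply/forallP => i; rewrite joint_block cards1. Qed.

Lemma joint_exceptE (a : forall i, A i) (i : N) :
  (Tagged A (a i) |: joint_except a i)%SET = joint a.
Proof. by apply: finset.setD1K; rewrite in_joint. Qed.

(** This invariance lets the subtracted reward of the other agents be treated like a baseline. *)
Lemma joint_except_upd (a : {dffun forall i, A i}) (i : N) (c : A i) :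
  joint_except (upd a i c) i = joint_except a i.
Proof.
apply/setP => -[j e]; rewrite !inE !in_joint/=.
have [ji|ji] := eqVneq j i; last first.
  rewrite (upd_neq _ _ _ _ ji); congr (~~ _ && _).
  by transitivity false; [|symmetry]; apply/eqP => /(congr1 tag)/= /eqP;
    rewrite (negbTE ji).
(* In block [i] the only element of a joint action is the removed one, so both memberships are
   false. *)
by move: e; rewrite ji => e; rewrite !eq_Tagged/= !andNb.
Qed.

Section Pme.
Context {R : realType}.
Implicit Types (F : {set ground A} -> R) (x : ground A -> R).

Lemma pme_factor_joint x (a : forall i, A i) (i : N) :
  pme_factor x (joint a) i = x (Tagged A (a i)).
Proof.
rewrite /pme_factor joint_block; case: pickP => [c|/(_ (a i))]; last by rewrite eqxx.
by rewrite (inj_eq set1_inj) => /eqP <-.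
Qed.

(* A feasible set other than a joint action misses some block, where its factor
   is [1 - 1]. *)
Lemma pme_simplex F x : (forall i, \sum_(c : A i) x (Tagged A c) = 1) ->
  pme F x = \sum_(a : {dffun forall i, A i})
    F (joint a) * \prod_i x (Tagged A (a i)).
Proof.
move=> x1; pose img := [set joint a | a : {dffun forall i, A i}]%SET.
rewrite /pme (bigID (fun S => S \in img))/= [X in _ + X]big1 ?addr0.
- rewrite (eq_bigl (fun S => S \in img)).
    rewrite big_imset/=; last by move=> ? ? _ _; exact: joint_inj.
    by apply: eq_bigr => a _; under eq_bigr do rewrite pme_factor_joint.
  by move=> S; apply: andb_idl => /imsetP[a _ ->]; exact: feasible_joint.
- move=> S /andP[_ SNimg].
  have [i iP] : exists i, forall c : A i, (S :&: block i)%SET != [set Tagged A c]%SET.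
    (* Otherwise [S] meets every block in one element, and these elements form a joint action equal
       to [S]. *)
    apply: contrapT => noi; move/negP: SNimg; apply.
    have ex i : exists c : A i, (S :&: block i)%SET = [set Tagged A c]%SET.
      apply: contrapT => noc; apply: noi; exists i => c.
      by apply/eqP => Sc; apply: noc; exists c.
    have [a aP] := fin_all_exists ex.
    apply/imsetP; exists (finfun a) => //; rewrite joint_finfun.
    apply/setP => -[i c]; rewrite in_joint/=.
    have /setP/(_ (Tagged A c)) := aP i; rewrite !inE/= eqxx andbT => ->.
    by rewrite -tag_eqE /tag_eq/= eqxx tagged_asE.
  rewrite (bigD1 i)//= /pme_factor; case: pickP => [c|_].
    by rewrite (negbTE (iP c)).
  by rewrite x1 subrr mul0r mulr0.
Qed.

End Pme.

End Joint.

(** * Expectations under independently sampled actions *)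

Section SampledActions.
Context {R : realType} {N : finType} {A : N -> finType}.
Context {d : measure_display} {T : measurableType d}.
Context (P : probability T R) (X : T -> forall i, A i) (q : forall i, A i -> R).
Context (X_meas : action_measurable X).
Context (X_samp : sampled_from P X q).
Context (q_gt0 : forall i c, 0 < q i c).
Context (q_sum1 : forall i, \sum_c q i c = 1).

Let Y w : {dffun forall i, A i} := finfun (X w).

Lemma joint_action_preimage (a : {dffun forall i, A i}) :
  Y @^-1` [set a] = [set w | forall i, X w i = a i].
Proof.
apply/seteqP; split=> w /=; first by move=> <- i; rewrite ffunE.
by move=> Xa; apply/ffunP => i; rewrite ffunE.
Qed.

Lemma measurable_joint_action (a : {dffun forall i, A i}) :
  measurable (Y @^-1` [set a]).
Proof.
rewrite joint_action_preimage.
rewrite (_ : [set w | _] = \bigcap_(i in [set` N]) [set w | X w i = a i]).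
  by apply: fin_bigcap_measurable => [|i _]; [exact: finite_finpred|exact: X_meas].
by apply/seteqP; split=> w /= Xa i; [move=> _|]; exact: Xa.
Qed.

Lemma measurable_others_play i (c : forall j, A j) :
  measurable (others_play X i c).
Proof.
rewrite (_ : others_play X i c =
    \bigcap_(j in [set` predC1 i]) [set w | X w j = c j]).
  by apply: fin_bigcap_measurable => [|j _]; [exact: finite_finpred|exact: X_meas].
by apply/seteqP; split=> w /= Xc j; exact: Xc.
Qed.

Lemma others_play_own (a : {dffun forall i, A i}) i (c : A i) :
  others_play X i a `&` [set w | X w i = c] = Y @^-1` [set upd a i c].
Proof.
rewrite joint_action_preimage; apply/seteqP; split=> w /=.
  move=> [Xa <-] j; have [->|ji] := eqVneq j i; first by rewrite upd_eq.
  by rewrite upd_neq// Xa.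
move=> Xa; split; last by rewrite Xa upd_eq.
by move=> j ji; rewrite Xa upd_neq.
Qed.

Lemma prob_joint_upd (a : {dffun forall i, A i}) i (c : A i) :
  P (Y @^-1` [set upd a i c]) = (q i c * \prod_(j | j != i) q j (a j))%:E.
Proof.
rewrite joint_action_preimage X_samp (bigD1 i)//= upd_eq.
by under eq_bigr do rewrite upd_neq//.
Qed.

(** Marginalization: the event is cut by the action of agent [i], and the weights [q i c] add up to
    1. *)
Lemma prob_others_play (a : {dffun forall i, A i}) i :
  P (others_play X i a) = (\prod_(j | j != i) q j (a j))%:E.
Proof.
have mC := measurable_others_play i a.
have := @expectation_fin_partition _ _ _ P (A i) (fun w => X w i)
  (fun _ => \1_(others_play X i a)) (fun c => X_meas i c)
  (fun _ => integrable_indic _ mC).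
rewrite expectation_indic// => ->; congr EFin.
rewrite -[RHS]mul1r -[X in _ = X * _](q_sum1 i) mulr_suml; apply: eq_bigr => c _.
rewrite /Rintegral integral_indic//; last exact: X_meas.
by rewrite [_ `&` _]others_play_own -[RHS]/(fine (_)%:E) -prob_joint_upd.
Qed.

(** Given the other actions, [b] is independent of the action of [i], which equals [a i] with
    probability [q i (a i)]. Fixing that action as well thus scales the law of [b] by this
    number. *)
Lemma Rintegral_cond_indep i (b : T -> R) (a : {dffun forall i, A i}) :
  P.-integrable setT (EFin \o b) -> cond_indep_own_action P X i b ->
  \int[P]_(w in Y @^-1` [set a]) b w =
  q i (a i) * \int[P]_(w in others_play X i a) b w.
Proof.
move=> ib indep_b.
have mb : measurable_fun setT b by apply/measurable_EFinP; case/integrableP: ib.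
have mC := measurable_others_play i a.
have upd_id : upd a i (a i) = a.
  apply/ffunP => j; have [->|ji] := eqVneq j i; first by rewrite upd_eq.
  by rewrite upd_neq.
apply: Rintegral_comp_scale => //; [exact: measurable_joint_action|exact/ltW|].
move=> B mB; have mbB : measurable (b @^-1` B).
  by rewrite -[X in measurable X]setTI; exact: mb.
have mE : measurable (b @^-1` B `&` Y @^-1` [set a]).
  by apply: measurableI => //; exact: measurable_joint_action.
have := indep_b a (a i) B mB; rewrite /cond_prob.
rewrite -setIA [X in _ `&` X]setIC (setIC [set w | _]) others_play_own upd_id.
rewrite -[in P (Y @^-1` [set a])]upd_id prob_joint_upd prob_others_play/=.
(* Positive action probabilities make the conditioning event non-null, so the denominators of
   [cond_prob] can be cleared. *)
have p_neq0 : \prod_(j | j != i) q j (a j) != 0.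
  by rewrite gt_eqF// prodr_gt0.
move=> /(congr1 ( *%R ^~ (\prod_(j | j != i) q j (a j)))).
rewrite (mulfK p_neq0) [RHS]mulrAC !divfK// => fineE.
rewrite -[LHS]fineK ?fin_num_measure// fineE mulrC EFinM fineK// fin_num_measure//.
exact: measurableI.
Qed.

Lemma fine_prob_joint_action (a : {dffun forall i, A i}) :
  fine (P (Y @^-1` [set a])) = \prod_i q i (a i).
Proof. by rewrite joint_action_preimage X_samp. Qed.

Lemma expectation_joint_action (g : {dffun forall i, A i} -> R) :
  'E_P[fun w => g (Y w)]%E = (\sum_a g a * \prod_i q i (a i))%:E.
Proof.
rewrite (expectation_fin_partition _ _ _ P _ Y (fun a _ => g a)).
- congr EFin; apply: eq_bigr => a _.
  rewrite Rintegral_cst; last exact: measurable_joint_action.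
  by rewrite fine_prob_joint_action.
- exact: measurable_joint_action.
- by move=> a; exact: finite_measure_integrable_cst.
Qed.

(* Each baseline, and each value of [f] without the action of [i], is averaged
   against the mean-zero score of the own action. *)
Lemma expectation_score (f : {set ground A} -> R) (b : N -> T -> R)
    (L : forall i, A i -> R) :
  (forall i, 0 < #|A i|)%N ->
  (forall i, \sum_c q i c * L i c = 0) ->
  (forall i, P.-integrable setT (EFin \o b i)) ->
  (forall i, cond_indep_own_action P X i (b i)) ->
  'E_P[fun w => (\sum_i (marginal f (Tagged A (X w i)) (joint_except (X w) i)
      - b i w) * L i (X w i))%R]%E =
  (\sum_(a : {dffun forall i, A i})
     f (joint a) * ((\sum_i L i (a i)) * \prod_i q i (a i)))%:E.
Proof.
move=> A_gt0 L0 ib indep_b.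
(* With the joint action frozen at [a], only the baseline remains random. *)
pose h (a : {dffun forall i, A i}) i w :=
  (f (joint a) - f (joint_except a i) - b i w) * L i (a i).
have icst r : P.-integrable setT (EFin \o (fun=> r : R)).
  exact: finite_measure_integrable_cst.
have iB a i : P.-integrable setT
    (EFin \o (fun w => f (joint a) - f (joint_except a i) - b i w)).
  exact: (integrableB measurableT (icst (f (joint a) - f (joint_except a i))) (ib i)).
have ih a i : P.-integrable setT (EFin \o h a i).
  exact: (integrableZr measurableT (L i (a i)) (iB a i)).
have mY := measurable_joint_action.
rewrite (_ : (fun w => _) = (fun w => \sum_i h (Y w) i w)); last first.
  apply/funext => w; apply: eq_bigr => i _.
  rewrite /h /marginal joint_exceptE joint_finfun ffunE.
  by rewrite /joint_except joint_finfun ffunE.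
rewrite (expectation_fin_partition _ _ _ P _ Y (fun a w => \sum_i h a i w)) //; last first.
  move=> a; rewrite (_ : _ \o _ = (fun w => \sum_i (EFin \o h a i) w)%E).
    exact: integrable_sum.
  by apply/funext => w; rewrite /= sumEFin.
congr EFin.
pose others (a : {dffun forall i, A i}) i := \prod_(j | j != i) q j (a j).
pose B (a : {dffun forall i, A i}) i := \int[P]_(w in others_play X i a) b i w.
(* The first term carries the full reward; in the second, the action of [i] enters only through
   [q i (a i) * L i (a i)]. *)
have int_h a i : \int[P]_(w in Y @^-1` [set a]) h a i w =
    f (joint a) * (L i (a i) * \prod_i q i (a i)) -
    (q i (a i) * L i (a i)) * (f (joint_except a i) * others a i + B a i).
  rewrite RintegralZr//; last exact: integrableS (iB a i).
  rewrite RintegralB//; [|exact: integrableS (icst _)|exact: integrableS (ib i)].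
  rewrite Rintegral_cst// (Rintegral_cond_indep i (b i) a (ib i) (indep_b i)).
  rewrite fine_prob_joint_action.
  rewrite (bigD1 i)//= -/(others a i) -/(B a i); ring.
have baseline0 i : \sum_(a : {dffun forall i, A i}) (q i (a i) * L i (a i)) *
    (f (joint_except a i) * others a i + B a i) = 0.
  apply: (sum_upd_eq0 _ i (fun c => q i c * L i c)
    (fun a => f (joint_except a i) * others a i + B a i)) => // a c.
  rewrite joint_except_upd; congr (_ * _ + _).
    by apply: eq_bigr => j ji; rewrite upd_neq.
  congr Rintegral; apply/seteqP.
  by split=> w Xc j ji; have := Xc j ji; rewrite upd_neq.
under eq_bigr => a _.
  rewrite Rintegral_sum//; last by move=> i; exact: integrableS (ih a i).
  under eq_bigr do rewrite int_h.
  over.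
(* The second terms cancel for a fixed agent after summing over joint actions, hence this exchange
   and the later one back. *)
rewrite exchange_big/=.
under eq_bigr do rewrite sumrB baseline0 subr0.
rewrite exchange_big/=; apply: eq_bigr => a _.
by rewrite mulr_suml mulr_sumr.
Qed.

End SampledActions.

(** * Derivatives of finite sums, products and logarithms *)

Section Deriv.
Context {R : realType} {V : normedModType R}.

Lemma differentiable_prodr (I : Type) (r : seq I) (f : I -> V -> R) x :
  (forall i, differentiable (f i) x) ->
  differentiable (fun y => \prod_(i <- r) f i y) x.
Proof.
move=> df; elim: r => [|i r IH].
  rewrite (_ : (fun y => _) = cst 1); first exact: differentiable_cst.
  by apply/funext => y; rewrite big_nil.
rewrite (_ : (fun y => _) = f i * (fun y => \prod_(j <- r) f j y)).
  exact: differentiableM.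
by apply/funext => y; rewrite big_cons.
Qed.

Lemma differentiable_sumr (I : Type) (r : seq I) (f : I -> V -> R) x :
  (forall i, differentiable (f i) x) ->
  differentiable (fun y => \sum_(i <- r) f i y) x.
Proof.
move=> df; elim: r => [|i r IH].
  rewrite (_ : (fun y => _) = cst 0); first exact: differentiable_cst.
  by apply/funext => y; rewrite big_nil.
rewrite (_ : (fun y => _) = f i + (fun y => \sum_(j <- r) f j y)).
  exact: differentiableD.
by apply/funext => y; rewrite big_cons.
Qed.

Lemma derive_sumr (I : Type) (r : seq I) (f : I -> V -> R) x v :
  (forall i, derivable (f i) x v) ->
  'D_v (fun y => \sum_(i <- r) f i y) x = \sum_(i <- r) 'D_v (f i) x.
Proof.
move=> df.
(* [is_derive] carries derivability of the tail through the induction together with its value. *)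
suff /@derive_val : is_derive x v (fun y => \sum_(i <- r) f i y)
    (\sum_(i <- r) 'D_v (f i) x) by [].
elim: r => [|i r IH].
  rewrite (_ : (fun y => _) = cst 0) ?big_nil; first exact: is_derive_cst.
  by apply/funext => y; rewrite big_nil.
rewrite (_ : (fun y => _) = f i + (fun y => \sum_(j <- r) f j y)).
  by rewrite big_cons; apply: is_deriveD => //; exact: derivableP.
by apply/funext => y; rewrite big_cons.
Qed.

Lemma derive_ln (f : V -> R) x v : 0 < f x -> differentiable f x ->
  'D_v (fun y => ln (f y)) x = 'D_v f x / f x.
Proof.
move=> fx_gt0 df.
have dln := is_derive1_ln fx_gt0.
have dfln : differentiable (@ln R) (f x) by apply/derivable1_diffP; case: dln.
rewrite deriveE; last exact: (differentiable_comp df dfln).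
rewrite (diff_comp df dfln)/= -deriveE//.
(* A linear map on the line is multiplication by its value at 1. *)
have ln_lin w : 'd (@ln R) (f x) w = w * 'D_1 (@ln R) (f x).
  by rewrite (deriveE _ dfln) -[in LHS](mulr1 w) [LHS]linearZ.
by rewrite (deriveE _ dfln) ln_lin -(deriveE v df) (@derive_val _ _ _ _ _ _ _ dln).
Qed.

(** Positivity allows the product rule in logarithmic form, where each quotient is the score of one
    factor. *)
Lemma derive_prodr (I : Type) (r : seq I) (f : I -> V -> R) x v :
  (forall i, 0 < f i x) -> (forall i, derivable (f i) x v) ->
  'D_v (fun y => \prod_(i <- r) f i y) x =
  (\sum_(i <- r) 'D_v (f i) x / f i x) * \prod_(i <- r) f i x.
Proof.
move=> f_gt0 df.
suff /@derive_val : is_derive x v (fun y => \prod_(i <- r) f i y)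
    ((\sum_(i <- r) 'D_v (f i) x / f i x) * \prod_(i <- r) f i x) by [].
elim: r => [|i r IH].
  rewrite (_ : (fun y => _) = cst 1) ?big_nil ?mul0r; first exact: is_derive_cst.
  by apply/funext => y; rewrite big_nil.
rewrite (_ : (fun y => _) = f i * (fun y => \prod_(j <- r) f j y)); last first.
  by apply/funext => y; rewrite big_cons.
have dfi := derivableP (df i).
apply: is_derive_eq.
rewrite !big_cons /GRing.scale/= mulrDl addrC; congr (_ + _).
  by rewrite mulrA divfK ?gt_eqF// mulrC.
by rewrite mulrCA.
Qed.

End Deriv.

(** The map [X] is fixed, and the parameter moves only the law [P theta']. Differentiability of [J]
    is asserted separately because [grad] is total and does not by itself ensure that derivatives
    exist. *)
Theorem lemma4p1 (R : realType) (n : nat)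
  (N : finType) (A : N -> finType) (State : Type) (Obs : N -> Type)
  (obs : forall i, State -> Obs i)
  (F : State -> {set ground A} -> R)
  (policy : forall i, 'rV[R]_n -> Obs i -> A i -> R)
  (s : State)
  (A_nonempty : forall i, (0 < #|A i|)%N)
  (F_ge0 : forall S, 0 <= F s S)
  (F_normalized : normalized_setfun (F s))
  (F_monotone : monotone_setfun (F s))
  (F_submodular : submodular_setfun (F s))
  (policy_gt0 : forall i theta a, 0 < policy i theta (obs i s) a)
  (policy_sum1 : forall i theta, \sum_(a : A i) policy i theta (obs i s) a = 1)
  (policy_diff : forall i a theta,
     differentiable (fun theta' => policy i theta' (obs i s) a) theta)
  (d : measure_display) (T : measurableType d)
  (P : 'rV[R]_n -> probability T R)
  (X : T -> forall i, A i)
  (X_measurable : action_measurable X)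
  (X_sampled : forall theta,
     sampled_from (P theta) X (fun i => policy i theta (obs i s)))
  (theta : 'rV[R]_n) (b : N -> T -> R)
  (b_integrable : forall i, (P theta).-integrable setT (EFin \o b i))
  (b_indep : forall i, cond_indep_own_action (P theta) X i (b i)) :
  let x : 'rV[R]_n -> ground A -> R := fun theta' e =>
    policy (tag e) theta' (obs (tag e) s) (tagged e) in
  let J : 'rV[R]_n -> R := fun theta' =>
    fine 'E_(P theta')[fun w => F s (joint (X w))]%E in
  let G : T -> 'rV[R]_n := fun w => \sum_(i : N)
    (marginal (F s) (Tagged A (X w i)) (joint_except (X w) i) - b i w) *:
    grad (fun theta' => ln (policy i theta' (obs i s) (X w i))) theta in
  [/\ forall theta', J theta' = pme (F s) (x theta'),
      differentiable J theta &
      forall k : 'I_n,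
        'E_(P theta)[fun w => (G w 0 k)%R]%E = (grad J theta 0 k)%:E].
Proof.
move=> x J G.
pose q th i (c : A i) := policy i th (obs i s) c.
pose p a th := \prod_i q th i (a i).
have JE : J = fun th => \sum_(a : {dffun forall i, A i}) F s (joint a) * p a th.
  apply/funext => th; rewrite /J.
  under [X in expectation _ X]funext do rewrite -joint_finfun.
  by rewrite (expectation_joint_action (P th) X (q th) X_measurable
    (X_sampled th) (fun a => F s (joint a))).
have dp a th : differentiable (p a) th.
  by apply: differentiable_prodr => i; exact: policy_diff.
have dFp a th : differentiable (fun th' => F s (joint a) * p a th') th.
  by apply: differentiableM => //; exact: dp.
split.
- by move=> th; rewrite JE pme_simplex// => i; exact: policy_sum1.
- by rewrite JE; apply: differentiable_sumr => a; exact: dFp.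
move=> k; pose v : 'rV[R]_n := delta_mx 0 k.
(* Coordinate [k] of the score of action [c], as a quotient. *)
pose L i (c : A i) := 'D_v (fun th => q th i c) theta / q theta i c.
have qL i (c : A i) : q theta i c * L i c = 'D_v (fun th => q th i c) theta.
  by rewrite /L mulrC divfK// gt_eqF// policy_gt0.
have dq i (c : A i) : derivable (fun th => q th i c) theta v.
  by apply: diff_derivable; exact: policy_diff.
have GE : (fun w => G w 0 k) = (fun w => \sum_i
    (marginal (F s) (Tagged A (X w i)) (joint_except (X w) i) - b i w) *
      L i (X w i)).
  apply/funext => w; rewrite /G summxE; apply: eq_bigr => i _.
  by rewrite !mxE derive_ln.
have L0 i : \sum_c q theta i c * L i c = 0.
  under eq_bigr do rewrite qL.
  rewrite -derive_sumr//.
  rewrite (_ : (fun th => _) = cst 1) ?derive_cst//.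
  by apply/funext => th; exact: policy_sum1.
rewrite GE (expectation_score (P theta) X (q theta) X_measurable (X_sampled theta)
  (fun i => policy_gt0 i theta) (fun i => policy_sum1 i theta)
  (F s) b L A_nonempty L0 b_integrable b_indep).
(* Both sides are now sums over joint actions, compared term by term. *)
congr EFin; rewrite mxE JE derive_sumr; last first.
  by move=> a; apply: diff_derivable; exact: dFp.
apply: eq_bigr => a _.
rewrite deriveMl; last by apply: diff_derivable; exact: dp.
congr (_ * _); rewrite derive_prodr// => i.
by exact: policy_gt0.
Qed.
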